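(* The space $(c_0)_p$ contains a closed infinite-dimensional vector subspace which is not isomorphic to $(c_0)_p$.
   Context: $(c_0)_p=\{(x_n)\in\mathbb{R}^{\mathbb{N}}: x_n\to 0\}$ is endowed with the topology inherited from the product $\mathbb{R}^{\mathbb{N}}$. Isomorphic means linearly homeomorphic (subspaces carry the subspace topology). *)

(* Defs.v *)
From HB Require Import structures.
From mathcomp Require Import all_boot all_order all_algebra.
From mathcomp Require Import all_classical all_reals all_analysis.

Set Implicit Arguments.
Unset Strict Implicit.
Unset Printing Implicit Defensive.

Import Order.TTheory GRing.Theory Num.Theory.
Import numFieldNormedType.Exports.

Local Open Scope classical_set_scope.
Local Open Scope ring_scope.

Section Subspaces.
Context {K : numDomainType}.

Definition linear_subspace {V : lmodType K} (E : set V) : Prop :=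
  GRing.submod_closed (mem E).

Definition finite_dimensional {V : lmodType K} (E : set V) : Prop :=
  exists (n : nat) (v : 'I_n -> V),
    (forall i, E (v i)) /\
    (forall x, E x -> exists c : 'I_n -> K, x = \sum_(i < n) c i *: v i).

Definition infinite_dimensional {V : lmodType K} (E : set V) : Prop :=
  ~ finite_dimensional E.

Definition closed_in {T : topologicalType} (A E : set T) : Prop :=
  E `<=` A /\ closed (E : set (subspace A)).

(* Only the restrictions of [f] to [E] and of [g] to [F] matter. As they map
   into [F] and [E], their continuity into the ambient spaces is the same as
   their continuity for the subspace topologies of [F] and [E]. *)
Definition isomorphic {V W : preTopologicalLmodType K}
    (E : set V) (F : set W) : Prop :=
  exists (f : V -> W) (g : W -> V),
    [/\ {homo f : x / E x >-> F x} /\ {homo g : y / F y >-> E y},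
        (forall x, E x -> g (f x) = x) /\ (forall y, F y -> f (g y) = y),
        (forall (a : K) (x y : V), E x -> E y ->
           f (a *: x + y) = a *: f x + f y),
        {within E, continuous f} &
        {within F, continuous g}].

End Subspaces.

(* The product topology on sequences, which bare arrow types do not carry. *)
Definition seq_space (R : realType) : Type := {ptws nat -> R^o}.

HB.instance Definition _ (R : realType) :=
  Topological.copy (seq_space R) {ptws nat -> R^o}.
HB.instance Definition _ (R : realType) :=
  GRing.Lmodule.copy (seq_space R) (nat -> R^o).

Definition c0 (R : realType) : set (seq_space R) :=
  [set x | x n @[n --> \oo] --> (0 : R)].
Arguments c0 : clear implicits.

(* Main.v *)
Require Import Defs.
From mathcomp Require Import all_boot all_order all_algebra.
From mathcomp Require Import all_classical all_reals all_analysis.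
From mathcomp Require Import ring lra.

Set Implicit Arguments.
Unset Strict Implicit.
Unset Printing Implicit Defensive.

Import Order.TTheory GRing.Theory Num.Theory.
Import numFieldNormedType.Exports.
Local Open Scope classical_set_scope.
Local Open Scope ring_scope.

(** Linear maps that are continuous for pointwise convergence are automatically
bounded for the sup norm, by the uniform boundedness principle. So a pointwise
closed subspace [E] of [c0] that is isomorphic to [c0] for pointwise
convergence is also isomorphic to it as a Banach space, and it suffices to find
an [E] that contains finite dimensional pieces which do not factor through [c0]
with a uniform bound.

Words over a three-letter alphabet are coded as natural numbers, and [E] is the
set of null sequences whose restriction to words is balanced: the three values
at [u ++ a :: v], for [a] ranging over the letters, always have sum zero. The
words of length [n] carry a piece [X_n] of [E], which is the [n]-th tensor
power of the plane [t_0 + t_1 + t_2 = 0], hence of dimension [2 ^ n]. In that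
plane [2 |t_a| <= |t_0| + |t_1| + |t_2|], and taking tensor powers gives that
the sup norm of an element of [X_n] is at most [(3 / 2) ^ n] times the mean of
its absolute values ([balanced_spread]).

Now let [f : E -> c0] and [g : c0 -> E] be inverse isomorphisms, bounded by [A]
and [B] ([uniform_bound]), and let [b_j] be the part of [g e_j] that lies in
[X_n]. The identity of [X_n] is the composite of [f] and the block of [g], so
its trace is [2 ^ n = \sum_j f_j(b_j)] ([trace_identity]). Each term is at most
[A] times the sup norm of [b_j], hence at most [A * (3 / 2) ^ n] times the mean
over the words [w] of [|b_j(w)|]. For every single [w], the sum over [j] of
[|b_j(w)|] is at most [B], being the norm of a coordinate of [g]
([row_sum_bound]). Therefore [2 ^ n <= A * B * (3 / 2) ^ n] for all [n], which
is absurd. *)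

(** * Linear maps between subspaces of the sequence space *)

Section SequenceSpace.
Context {R : realType}.
Implicit Types (x y : seq_space R) (E : set (seq_space R)).

(* The cast makes a coordinate live in [R] itself instead of [R^o]. *)
Local Notation "x `[ n ]" := ((x : nat -> R) n)
  (at level 1, left associativity, format "x `[ n ]").

Lemma seq_space_coord_continuous n : continuous (fun x => x n : R^o).
Proof. exact: (@proj_continuous nat (fun=> R^o : topologicalType) n). Qed.

Lemma seq_space_cvgP (X : nat -> seq_space R) x :
  X k @[k --> \oo] --> x <-> forall n, X k n @[k --> \oo] --> (x n : R^o).
Proof. exact: (@pointwise_cvgP nat R^o (X @ \oo) x). Qed.

Lemma within_continuous_coord E (f : seq_space R -> seq_space R)
    (X : nat -> seq_space R) x n :
  {within E, continuous f} -> (forall k, E (X k)) -> E x ->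
  (forall i, X k i @[k --> \oo] --> (x i : R^o)) ->
  f (X k) n @[k --> \oo] --> (f x n : R^o).
Proof.
move=> /subspace_continuousP cf EX Ex /seq_space_cvgP cX.
have cfX : f (X k) @[k --> \oo] --> f x.
  move=> A /(cf x Ex) nA.
  have /cX : nbhs x (fun y => E y -> A (f y)) by exact: nA.
  rewrite !nbhs_simpl /=; apply: filterS => k; apply; exact: EX.
by move/seq_space_cvgP: cfX; apply.
Qed.

Definition linear_on E (f : seq_space R -> seq_space R) :=
  forall a x y, E x -> E y -> f (a *: x + y) = a *: f x + f y.

Lemma subspace0 E : linear_subspace E -> E 0.
Proof. by case=> /set_mem. Qed.

Lemma subspaceD E a x y :
  linear_subspace E -> E x -> E y -> E (a *: x + y).
Proof. by case=> _ h Ex Ey; apply: set_mem; apply: h; exact: mem_set. Qed.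

Lemma subspaceZ E a x : linear_subspace E -> E x -> E (a *: x).
Proof.
move=> sE Ex; rewrite -[_ *: _]addr0; apply: subspaceD => //.
exact: subspace0.
Qed.

Lemma subspace_sum E (I : Type) (r : seq I) (a : I -> R)
    (X : I -> seq_space R) :
  linear_subspace E -> (forall i, E (X i)) -> E (\sum_(i <- r) a i *: X i).
Proof.
move=> sE EX; elim: r => [|i r IH]; first by rewrite big_nil; exact: subspace0.
by rewrite big_cons; exact: subspaceD.
Qed.

Lemma linear_on0 E f : linear_subspace E -> linear_on E f -> f 0 = 0.
Proof.
move=> sE lf; have E0 := subspace0 sE.
have /esym/eqP := lf 1 0 0 E0 E0.
rewrite scaler0 addr0 scale1r -[X in _ == X]addr0.
by rewrite (inj_eq (addrI _)) => /eqP.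
Qed.

Lemma linear_onZ E f a x : linear_subspace E -> linear_on E f -> E x ->
  f (a *: x) = a *: f x.
Proof.
move=> sE lf Ex; have E0 := subspace0 sE.
by rewrite -[_ *: x]addr0 lf// (linear_on0 sE lf) addr0.
Qed.

Lemma linear_on_sum E f (I : Type) (r : seq I) (a : I -> R)
    (X : I -> seq_space R) :
  linear_subspace E -> linear_on E f -> (forall i, E (X i)) ->
  f (\sum_(i <- r) a i *: X i) = \sum_(i <- r) a i *: f (X i).
Proof.
move=> sE lf EX; elim: r => [|i r IH].
  by rewrite !big_nil (linear_on0 sE lf).
by rewrite !big_cons lf ?IH//; exact: subspace_sum.
Qed.

Lemma coord_sum (I : Type) (r : seq I) (a : I -> R) (X : I -> seq_space R) n :
  (\sum_(i <- r) a i *: X i)`[n] = \sum_(i <- r) a i * (X i)`[n].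
Proof. by elim: r => [|i r IH]; rewrite ?big_nil// !big_cons -IH. Qed.

(** A coordinate of [f] that no finite set of coordinates controls would take
the value 1 along a sequence that converges to 0 coordinatewise. One number [N]
serves for the set of coordinates and for the constant. *)
Lemma coord_local_bound E f n : linear_subspace E -> linear_on E f ->
  {within E, continuous f} ->
  exists N, forall x M, E x -> (forall i, (i < N.+1)%N -> `|x`[i]| <= M) ->
    `|(f x)`[n]| <= N.+1%:R * M.
Proof.
move=> sE lf cf; apply: contrapT => /forallNP H.
have {}H N : exists z, [/\ E z, (f z)`[n] = 1 &
    forall i, (i < N.+1)%N -> `|z`[i]| <= N.+1%:R^-1].
  have /existsNP[x /existsNP[M /not_implyP[Ex /not_implyP[xM /negP]]]] := H N.
  rewrite -ltNge => fxM.
  have M0 : 0 <= M by exact: le_trans (xM 0%N _).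
  have t0 : 0 < `|(f x)`[n]| by apply: le_lt_trans fxM; rewrite mulr_ge0.
  exists ((f x)`[n]^-1 *: x); split; first exact: subspaceZ.
    rewrite (linear_onZ _ sE lf Ex).
    change ((f x)`[n]^-1 * (f x)`[n] = 1).
    by rewrite mulVf// -normr_gt0.
  move=> i iN; change (`|(f x)`[n]^-1 * x`[i]| <= N.+1%:R^-1).
  rewrite normrM normfV ler_pdivrMl// -ler_pdivrMr ?invr_gt0// invrK.
  rewrite mulrC; apply: le_trans (ltW fxM).
  by rewrite ler_pM2l ?ltr0n// xM.
have [Z HZ] := choice H.
have : f (Z k) n @[k --> \oo] --> (f 0 n : R^o).
  apply: within_continuous_coord cf _ (subspace0 sE) _.
    by move=> k; have [] := HZ k.
  move=> i; apply/cvgrPdist_le => e e0; near=> k.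
  rewrite sub0r normrN; have [_ _ /(_ i)] := HZ k.
  have ik : (i < k.+1)%N by rewrite ltnS; near: k; exact: nbhs_infty_ge.
  move=> /(_ ik) /le_trans; apply; apply: ltW.
  by near: k; exact: near_infty_natSinv_lt (PosNum e0).
under eq_fun => k do have [_ -> _] := HZ k.
rewrite (linear_on0 sE lf) => /cvg_unique => /(_ _ 1).
move=> /(_ (@Rhausdorff R) (cvg_cst _)) /eqP.
by rewrite eq_sym oner_eq0.
Unshelve. all: by end_near. Qed.

(** * Uniform boundedness *)

Lemma geometric_unbounded (B : R) : exists k, B < (4%:R / 3%:R) ^+ k.
Proof.
have bern k : 1 + k%:R / 3%:R <= (4%:R / 3%:R : R) ^+ k.
  elim: k => [|k IH]; first by rewrite mul0r addr0 expr0.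
  rewrite exprS -natr1.
  have k0 : 0 <= k%:R :> R by [].
  nra.
exists (Num.bound `|3%:R * B|); apply: lt_le_trans (bern _).
have := archi_boundP (normr_ge0 (3%:R * B)).
by have := ler_norm (3%:R * B); lra.
Qed.

Lemma c0_coord_bounded x : c0 R x -> exists B, forall n, `|x`[n]| <= B.
Proof.
move=> /cvgP /cvg_seq_bounded [M [_ HM]].
by exists (M + 1) => n; apply: (HM (M + 1)) => //; rewrite ltrDl.
Qed.

Lemma c0_unif_limit (X : nat -> seq_space R) x :
  (forall k, c0 R (X k)) ->
  (forall e, 0 < e -> exists k, forall n, `|x`[n] - (X k)`[n]| <= e) ->
  c0 R x.
Proof.
move=> X0 ux; apply/cvgrPdist_le => e e0.
have e20 : 0 < e / 2 by rewrite divr_gt0.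
have [k xXk] := ux _ e20.
have /cvgrPdist_le /(_ _ e20) := X0 k; apply: filterS => n.
rewrite !sub0r !normrN => Xk; have := xXk n.
have := ler_normD (x`[n] - (X k)`[n]) (X k)`[n]; rewrite subrK.
move=> h1 h2; apply: le_trans h1 _; lra.
Qed.

(** With [t k = 3 / 2 * 3^-1 ^+ k], whose decrements are [3^-1 ^+ k], the
sequences [u + t] and [u - t] are monotone and enclose [u]. *)
Lemma geometric_steps_limit (u : nat -> R) :
  (forall k, `|u k.+1 - u k| <= 3%:R^-1 ^+ k) ->
  exists2 l, u k @[k --> \oo] --> l &
    forall k, `|l - u k| <= 3%:R / 2%:R * 3%:R^-1 ^+ k.
Proof.
move=> du; pose t k : R := 3%:R / 2%:R * 3%:R^-1 ^+ k.
have tS k : t k.+1 = t k - 3%:R^-1 ^+ k by rewrite /t exprS; field.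
have t0 : t k @[k --> \oo] --> 0.
  rewrite -[0](mulr0 (3%:R / 2%:R)); apply: cvgMr; apply: cvg_expr.
  by rewrite ger0_norm ?invr_ge0// invf_lt1// ltr1n.
have dec : nonincreasing_seq (fun k => u k + t k).
  apply/nonincreasing_seqP => k; rewrite tS.
  by have := du k; rewrite ler_norml => /andP[_]; lra.
have inc : nondecreasing_seq (fun k => u k - t k).
  apply/nondecreasing_seqP => k; rewrite tS.
  by have := du k; rewrite ler_norml => /andP[+ _]; lra.
have tge k : 0 <= t k by rewrite /t mulr_ge0// exprn_ge0// invr_ge0.
have cdec : cvgn (fun k => u k + t k).
  apply: nonincreasing_is_cvgn => //; exists (u 0%N - t 0%N) => _ [k _ <-].
  by apply: le_trans (inc 0%N k (leq0n k)) _; have := tge k; lra.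
have cl : u k @[k --> \oo] --> limn (fun k => u k + t k).
  rewrite -[X in _ --> X]subr0.
  under eq_fun => k do rewrite -[u k](addrK (t k)).
  exact: cvgB.
exists (limn (fun k => u k + t k)) => // k; rewrite -/(t k) ler_norml.
apply/andP; split; last first.
  by rewrite lerBlDr addrC; apply: nonincreasing_cvgn_ge.
rewrite lerBrDr addrC.
have <- : limn (fun k => u k - t k) = limn (fun k => u k + t k).
  by apply: cvg_lim => //; rewrite -[X in _ --> X]subr0; exact: cvgB.
by apply: nondecreasing_cvgn_le => //; exact: cvgP (cvgB cl t0).
Qed.

Lemma closed_in_c0_seq E (X : nat -> seq_space R) x :
  closed_in (c0 R) E -> (forall k, E (X k)) -> c0 R x ->
  (forall n, X k n @[k --> \oo] --> (x n : R^o)) -> E x.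
Proof.
move=> [Ec0 /closed_subspaceP[V cV VE]] EX x0 /seq_space_cvgP Xx.
suff : (E `&` c0 R) x by case.
rewrite -VE; split=> //; apply: (closed_cvg V cV) Xx.
apply: nearW => k; suff : (V `&` c0 R) (X k) by case.
by rewrite VE; split=> //; exact: Ec0.
Qed.

(** The number [s] is the norm of the functional [x |-> (f x)`[n]] on [E], for
the sup norm. *)
Lemma coord_norm E f n : linear_subspace E -> linear_on E f ->
  {within E, continuous f} ->
  exists s : R, (forall x M, E x -> (forall i, `|x`[i]| <= M) ->
      `|(f x)`[n]| <= s * M) /\
    forall e : R, 0 < e -> exists x, [/\ E x, forall i, `|x`[i]| <= 1 &
      s - e < `|(f x)`[n]| ].
Proof.
move=> sE lf cf; have [N fN] := coord_local_bound n sE lf cf.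
have E0 := subspace0 sE.
pose A := [set `|(f x)`[n]| | x in [set x | E x /\ forall i, `|x`[i]| <= 1]].
have A0 : A !=set0.
  by exists `|(f 0)`[n]|, 0 => //; split=> // i; rewrite [X in `|X|]/= normr0.
have supA : has_sup A.
  split=> //; exists (N.+1%:R * 1) => _ [x [Ex x1] <-]; exact: fN.
exists (sup A); split; last first.
  by move=> e e0; have [_ [x [Ex x1] <-] ?] := sup_adherent e0 supA; exists x.
move=> x M Ex xM.
have M0 : 0 <= M by exact: le_trans (xM 0%N).
have [M_eq0|M_neq0] := eqVneq M 0.
  have := fN x 0 Ex; rewrite M_eq0 !mulr0; apply=> i _.
  by rewrite -M_eq0.
have Mgt0 : 0 < M by rewrite lt0r M_neq0.
have : A `|(f (M^-1 *: x))`[n]|.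
  exists (M^-1 *: x) => //; split; first exact: subspaceZ.
  move=> i; change (`|M^-1 * x`[i]| <= 1).
  by rewrite normrM normfV (ger0_norm M0) ler_pdivrMl// mulr1.
move=> /(sup_upper_bound supA); rewrite (linear_onZ _ sE lf Ex).
change (`|M^-1 * (f x)`[n]| <= sup A -> `|(f x)`[n]| <= sup A * M).
by rewrite normrM normfV (ger0_norm M0) ler_pdivrMl// mulrC.
Qed.

(** Sokal's gliding hump. If the norms [s n] of the coordinates of [f] were
unbounded, pick coordinates [n_k] of norm more than [4 ^ k] and vectors [z_k] of
size at most [3 ^- k] where the coordinate is at least [3 / 4] of [3 ^- k] times
its norm. At [n_k], the larger of [f (y + z_k)] and [f (y - z_k)] is at least as
large as [f z_k]. So the signs of the [z_k] can be chosen one after the other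
such that the [k]-th partial sum of their series keeps the size of [f z_k] at
[n_k]; the later terms are too small to undo this. If [y] is the sum of the
series, then [f y] is unbounded, although it tends to 0. *)
Lemma uniform_bound E f : linear_subspace E -> closed_in (c0 R) E ->
  linear_on E f -> {within E, continuous f} -> (forall x, E x -> c0 R (f x)) ->
  exists2 C : R, 0 <= C & forall x M n, E x -> (forall i, `|x`[i]| <= M) ->
    `|(f x)`[n]| <= C * M.
Proof.
move=> sE cE lf cf f0.
have [s Hs] := choice (fun n => coord_norm n sE lf cf).
suff [C sC] : exists C, forall n, s n <= C.
  exists (Num.max C 0); first by rewrite le_max lexx orbT.
  move=> x M n Ex xM; have [/(_ _ _ Ex xM) h _] := Hs n.
  apply: le_trans h _; rewrite ler_wpM2r//; first exact: le_trans (xM 0%N).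
  by rewrite le_max sC.
apply: contrapT => /forallNP unb.
have {}unb k : exists nx : nat * seq_space R, [/\ 4%:R ^+ k < s nx.1, E nx.2,
    forall i, `|nx.2`[i]| <= 1 & 3%:R / 4%:R * s nx.1 <= `|(f nx.2)`[nx.1]| ].
  have /existsNP[n /negP] := unb (4%:R ^+ k); rewrite -ltNge => sn.
  have s0 : 0 < s n by apply: lt_trans sn; rewrite exprn_gt0.
  have [_ /(_ (s n / 4%:R))] := Hs n.
  rewrite divr_gt0// => /(_ isT)[x [Ex x1 fx]].
  by exists (n, x); split=> //=; apply: ltW; apply: le_lt_trans fx; lra.
have {unb}[nx Hnx] := choice unb.
pose z k : seq_space R := 3%:R^-1 ^+ k *: (nx k).2.
pose step k y := if `|(f (z k))`[(nx k).1]| <= `|(f (y + z k))`[(nx k).1]|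
   then 1 *: z k + y else (-1) *: z k + y.
pose Y := fix Y k := if k is k'.+1 then step k' (Y k') else 0.
have q0 k : 0 < 3%:R^-1 ^+ k :> R by rewrite exprn_gt0// invr_gt0.
have Ez k : E (z k) by have [_ h _ _] := Hnx k; exact: subspaceZ.
have EY k : E (Y k).
  elim: k => [|k IH] /=; first exact: subspace0.
  by rewrite /step; case: ifP => _; exact: subspaceD.
have zle k i : `|(z k)`[i]| <= 3%:R^-1 ^+ k.
  change (`|3%:R^-1 ^+ k * (nx k).2`[i]| <= 3%:R^-1 ^+ k).
  have [_ _ h _] := Hnx k.
  by rewrite normrM (gtr0_norm (q0 k)) ler_piMr// ltW.
have dY k i : `|(Y k.+1)`[i] - (Y k)`[i]| <= 3%:R^-1 ^+ k.
  rewrite /= /step; case: ifP => _.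
    change (`|1 * (z k)`[i] + (Y k)`[i] - (Y k)`[i]| <= 3%:R^-1 ^+ k).
    by rewrite addrK mul1r.
  change (`|-1 * (z k)`[i] + (Y k)`[i] - (Y k)`[i]| <= 3%:R^-1 ^+ k).
  by rewrite addrK mulN1r normrN.
have fz k :
    3%:R^-1 ^+ k * (3%:R / 4%:R * s (nx k).1) <= `|(f (z k))`[(nx k).1]|.
  have [_ Ex _ h] := Hnx k; rewrite /z (linear_onZ _ sE lf Ex).
  change (3%:R^-1 ^+ k * (3%:R / 4%:R * s (nx k).1) <=
    `|3%:R^-1 ^+ k * (f (nx k).2)`[(nx k).1]|).
  by rewrite normrM (gtr0_norm (q0 k)) ler_pM2l.
have fY k : `|(f (z k))`[(nx k).1]| <= `|(f (Y k.+1))`[(nx k).1]|.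
  rewrite /= /step; case: ifP => [|/negbT]; first by rewrite scale1r addrC.
  have -> : f (Y k + z k) = 1 *: f (z k) + f (Y k).
    by rewrite -lf// scale1r addrC.
  rewrite -ltNge lf//.
  set n := (nx k).1.
  change (`|1 * (f (z k))`[n] + (f (Y k))`[n]| < `|(f (z k))`[n]| ->
    `|(f (z k))`[n]| <= `|-1 * (f (z k))`[n] + (f (Y k))`[n]|).
  move: ((f (z k))`[n]) ((f (Y k))`[n]) => a b; rewrite mul1r mulN1r => h.
  have := ler_normB (a + b) (- a + b).
  have -> : a + b - (- a + b) = a + a by ring.
  rewrite -mulr2n normrMn mulr2n; lra.
have lims i := geometric_steps_limit (fun k => dY k i).
pose y : seq_space R := fun i => sval (cid2 (lims i)).
have ylim i : (Y k)`[i] @[k --> \oo] --> y`[i].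
  by rewrite /y /=; case: cid2.
have ydist k i : `|y`[i] - (Y k)`[i]| <= 3%:R / 2%:R * 3%:R^-1 ^+ k.
  by rewrite /y /=; case: cid2.
have y0 : c0 R y.
  apply: (@c0_unif_limit Y); first by move=> k; exact: cE.1.
  move=> e e0; have [k] := geometric_unbounded (3%:R / 2%:R / e).
  rewrite ltr_pdivrMr// => ke; exists k => i; apply: le_trans (ydist k i) _.
  rewrite exprVn ler_pdivrMr ?exprn_gt0//; apply: le_trans (ltW ke) _.
  rewrite mulrC ler_pM2l// lerXn2r ?nnegrE//; lra.
have Ey : E y by exact: closed_in_c0_seq cE EY y0 ylim.
have [B fyB] := c0_coord_bounded (f0 _ Ey).
have [k] := geometric_unbounded (4%:R * B); apply/negP; rewrite -leNgt.
have [+ _] := Hs (nx k).1; set n := (nx k).1.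
move=> /(_ (-1 *: Y k.+1 + y) (2%:R^-1 * 3%:R^-1 ^+ k)).
have -> // : `|(f (-1 *: Y k.+1 + y))`[n]| = `|(f y)`[n] - (f (Y k.+1))`[n]|.
  rewrite lf//.
  change (`|-1 * (f (Y k.+1))`[n] + (f y)`[n]| =
    `|(f y)`[n] - (f (Y k.+1))`[n]|).
  by rewrite mulN1r addrC.
move=> /(_ (subspaceD _ sE (EY _) Ey)).
have diff i : `|(-1 *: Y k.+1 + y)`[i]| <= 2%:R^-1 * 3%:R^-1 ^+ k.
  change (`|-1 * (Y k.+1)`[i] + y`[i]| <= 2%:R^-1 * 3%:R^-1 ^+ k).
  rewrite mulN1r addrC; apply: le_trans (ydist k.+1 i) _.
  by rewrite exprS; have := q0 k; lra.
move=> /(_ diff) h1; have h2 := fY k; have h3 := fz k; have h4 := fyB n.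
have [h5 _ _ _] := Hnx k; rewrite -/n in h2 h3 h5.
(* At [n], by [fz] and [fY] the partial sum has at least [3 / 4] of
   [3^-1 ^+ k * s n], and by [h1] the remainder has at most half of it. *)
have h7 : `|(f (Y k.+1))`[n]| <= `|(f y)`[n]| + `|(f y)`[n] - (f (Y k.+1))`[n]|.
  by have := ler_normB (f y)`[n] ((f y)`[n] - (f (Y k.+1))`[n]); rewrite subKr.
have h8 : (4%:R / 3%:R) ^+ k <= 3%:R^-1 ^+ k * s n.
  by rewrite exprMn mulrC ler_pM2l// ltW.
move: (3%:R^-1 ^+ k) h1 h3 h8 => q h1 h3 h8.
have {}h1 : `|(f y)`[n] - (f (Y k.+1))`[n]| <= 2%:R^-1 * (q * s n).
  by apply: le_trans h1 _; rewrite mulrCA [q * _]mulrC.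
have {}h3 : 3%:R / 4%:R * (q * s n) <= `|(f (z k))`[n]| by rewrite mulrCA.
lra.
Qed.
End SequenceSpace.

(** * Balanced functions on words *)

Notation word := (seq 'I_3).

Fixpoint words n : seq word :=
  if n is n'.+1 then [seq a :: w | a <- index_enum 'I_3, w <- words n']
  else [:: [::]].

Lemma mem_words n w : (w \in words n) = (size w == n).
Proof.
elim: n w => [|n IH] w; first by rewrite inE size_eq0.
apply/allpairsP/eqP => [[[a v] /= [_]]|].
  by rewrite IH => /eqP <- ->.
case: w => // a v [] vn; exists (a, v); split=> //=.
  exact: mem_index_enum.
by rewrite IH vn.
Qed.

Section Balanced.
Context {R : realType}.
Implicit Types b : word -> R.

Definition balanced b := forall u v, \sum_a b (u ++ a :: v) = 0.

Lemma big_wordsS n b :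
  \sum_(w <- words n.+1) b w = \sum_a \sum_(w <- words n) b (a :: w).
Proof. by rewrite /= big_allpairs_dep. Qed.

Lemma size_words n : size (words n) = (3 ^ n)%N.
Proof.
elim: n => //= n IH.
by rewrite size_allpairs IH expnS /index_enum -enumT -cardE card_ord.
Qed.

Lemma balanced_cons b a : balanced b -> balanced (fun w => b (a :: w)).
Proof. by move=> bb u v; exact: (bb (a :: u) v). Qed.

Lemma sum3 (F : 'I_3 -> R) (a : 'I_3) : \sum_c F c = 0 ->
  2%:R * `|F a| <= \sum_c `|F c|.
Proof.
move=> F0; rewrite (bigD1 a)//= [2%:R]mulr2n mulrDl mul1r lerD2l.
move: F0; rewrite (bigD1 a)//= => /eqP; rewrite addr_eq0 => /eqP ->.
by rewrite normrN; exact: ler_norm_sum.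
Qed.

(** The inequality of [sum3], applied to one letter at a time. Equivalently,
the value of a balanced function at a word of length [n] is at most
[(3 / 2) ^ n] times its mean absolute value on the words of that length. *)
Lemma balanced_spread b n w : balanced b -> size w = n ->
  2%:R ^+ n * `|b w| <= \sum_(u <- words n) `|b u|.
Proof.
elim: n b w => [|n IH] b w bb.
  by move/size0nil ->; rewrite expr0 mul1r /= big_seq1.
case: w => // a w [] wn.
rewrite (big_wordsS n (fun u => `|b u|)) exchange_big /= exprS -mulrA.
apply: (@le_trans _ _ (2%:R * \sum_(u <- words n) `|b (a :: u)|)).
  by rewrite ler_pM2l//; exact: IH (balanced_cons a bb) wn.
rewrite mulr_sumr; apply: ler_sum => u _.
by apply: (sum3 (F := fun c => b (c :: u))); exact: (bb [::] u).
Qed.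

(** Up to the factor [3 ^ n], the kernel of the projection onto balanced
functions on words of length [n]: the tensor power of the matrix with diagonal
entries 2 and other entries -1. The scaling keeps the entries integral. *)
Fixpoint kern (w u : word) : R :=
  match w, u with
  | [::], [::] => 1
  | a :: w', c :: u' => ((a == c)%:R * 3%:R - 1) * kern w' u'
  | _, _ => 0
  end.

Lemma kern_diag w : kern w w = 2%:R ^+ size w.
Proof.
elim: w => //= a w ->; rewrite eqxx exprS; congr (_ * _); rewrite mul1r; lra.
Qed.

Lemma sum_eq3 (a : 'I_3) : \sum_(c < 3) ((a == c)%:R * 3%:R - 1) = 0 :> R.
Proof.
rewrite sumrB -mulr_suml (bigD1 a)//= eqxx big1 ?addr0; last first.
  by move=> c /negbTE; rewrite eq_sym => ->.
by rewrite sumr_const card_ord mul1r subrr.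
Qed.

Lemma kern_balanced w : balanced (kern w).
Proof.
move=> u; elim: u w => [|c u IH] [|a w] v /=.
- by rewrite big1.
- by rewrite -mulr_suml sum_eq3 mul0r.
- by rewrite big1.
- by rewrite -mulr_sumr IH mulr0.
Qed.

Lemma kern_proj b n u : balanced b -> size u = n ->
  \sum_(w <- words n) b w * kern w u = 3%:R ^+ n * b u.
Proof.
elim: n b u => [|n IH] b u bb.
  by move/size0nil ->; rewrite /= big_seq1 expr0 mulr1 mul1r.
case: u => // c u [] un.
rewrite (big_wordsS n (fun w => b w * kern w (c :: u))) /=.
under eq_bigr => a _.
  under eq_bigr => w _ do rewrite mulrCA.
  rewrite -mulr_sumr (IH (fun w => b (a :: w)))//; last exact: balanced_cons.
  over.
rewrite /= (eq_bigr (fun a => 3%:R * 3%:R ^+ n * ((a == c)%:R * b (a :: u)) -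
  3%:R ^+ n * b (a :: u))); last by move=> a _; ring.
rewrite sumrB -!mulr_sumr (bb [::] u) mulr0 subr0 exprS; congr (_ * _).
rewrite (bigD1 c)//= eqxx mul1r big1 ?addr0// => a /negbTE ->.
by rewrite mul0r.
Qed.

End Balanced.

(** * The subspace of balanced null sequences *)

Section Space.
Context {R : realType}.
Implicit Types (x y : seq_space R) (b : word -> R).
Local Notation "x `[ n ]" := ((x : nat -> R) n)
  (at level 1, left associativity, format "x `[ n ]").

Definition on_words x : word -> R := fun w => x`[pickle w].

Definition balanced_c0 : set (seq_space R) :=
  [set x | c0 R x /\ balanced (on_words x)].

(** Codes are decoded with [pickle_inv], which fails outside the range of
[pickle], so that the block has finite support. *)
Definition block n b : seq_space R := fun m =>
  if pickle_inv m is Some w then if size w == n then b w else 0 else 0 : R.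

Lemma block_on_words n b w :
  on_words (block n b) w = if size w == n then b w else 0.
Proof. by rewrite /on_words /block pickleK_inv. Qed.

Lemma c0_finite_support x N : (forall m, (N <= m)%N -> x`[m] = 0) -> c0 R x.
Proof.
move=> xN; apply/cvgrPdist_le => e e0; near=> m.
rewrite xN ?subrr ?normr0 ?ltW//; near: m; exact: nbhs_infty_ge.
Unshelve. all: by end_near. Qed.

Lemma c0_linear : linear_subspace (c0 R).
Proof.
split; first by apply/mem_set; apply: (@c0_finite_support _ 0%N).
move=> a x y /set_mem x0 /set_mem y0; apply/mem_set; rewrite /c0 /=.
rewrite -[X in _ --> X](addr0 0) -[X in _ --> X + _](mulr0 a).
by apply: cvgD => //; exact: cvgMr.
Qed.

Lemma c0_closed : closed_in (c0 R) (c0 R).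
Proof. by split=> //; exact: closed_subspaceT. Qed.

Lemma balanced_c0_linear : linear_subspace balanced_c0.
Proof.
split.
  apply/mem_set; split; first exact: subspace0 c0_linear.
  by move=> u v; rewrite big1.
move=> a x y /set_mem[x0 bx] /set_mem[y0 by_]; apply/mem_set; split.
  exact: subspaceD c0_linear _ _.
move=> u v.
change (\sum_c (a * on_words x (u ++ c :: v) +
  on_words y (u ++ c :: v)) = 0).
by rewrite big_split /= -mulr_sumr bx by_ mulr0 addr0.
Qed.

Lemma balanced_c0_closed : closed_in (c0 R) balanced_c0.
Proof.
split; first by move=> x [].
apply/closed_subspaceP.
exists [set x | balanced (on_words x)]; last first.
  by apply/seteqP; split=> x /= [] => [bx x0|[_ bx] x0].
have -> : [set x | balanced (on_words x)] =
    \bigcap_(u in [set: word]) \bigcap_(v in [set: word])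
      (fun x => \sum_a on_words x (u ++ a :: v) : R^o) @^-1` [set 0].
  apply/seteqP; split => x /= h u //; first by move=> _ v _; exact: h.
  by move=> v; exact: h.
apply: closed_bigI => u _; apply: closed_bigI => v _.
apply: preimage_closed; last exact: closed_eq.
move=> x _; apply: (continuous_big (@add_continuous R^o)) => a _.
exact: seq_space_coord_continuous.
Qed.

Lemma block_balanced n b : balanced b -> balanced_c0 (block n b).
Proof.
move=> bb; split.
  apply: (@c0_finite_support _ (\max_(w <- words n) (pickle w).+1)) => m Nm.
  rewrite /block; case E: (pickle_inv m) => [w|]//; case: eqP => // wn.
  have := @pickle_invK word m; rewrite E /= => mw.
  move: Nm; rewrite leqNgt => /negP[]; rewrite -mw.
  by apply: leq_bigmax_seq => //; rewrite mem_words wn.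
move=> u v; under eq_bigr => a _ do rewrite block_on_words size_cat /=.
by case: eqP => _; [exact: bb|rewrite big1].
Qed.

End Space.

Section Main.
Context {R : realType}.
Implicit Types (x y : seq_space R) (b : word -> R).
Local Notation "x `[ n ]" := ((x : nat -> R) n)
  (at level 1, left associativity, format "x `[ n ]").

(** The vectors [X k], supported on words of distinct lengths, are independent:
the word [nseq k ord0] detects the [k]-th one alone. *)
Lemma balanced_c0_infinite : infinite_dimensional (@balanced_c0 R).
Proof.
move=> [n [v [_ spanv]]].
pose w0 k : word := nseq k ord0.
pose X k : seq_space R := block k (kern (w0 k)).
have EX k : balanced_c0 (X k) := block_balanced k (kern_balanced (w0 k)).
have Xw j k : on_words (X j) (w0 k) = if k == j then 2%:R ^+ k else 0.
  rewrite block_on_words size_nseq; case: eqP => // ->.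
  by rewrite kern_diag size_nseq.
have [c Xc] := choice (fun k => spanv (X k) (EX k)).
pose C : 'M[R]_(n.+1, n) := \matrix_(k, i) c k i.
have : kermx C != 0.
  rewrite -mxrank_eq0 mxrank_ker -lt0n subn_gt0.
  exact: leq_ltn_trans (rank_leq_col C) _.
case/rowV0Pn => l /sub_kermxP lC /negP; apply; apply/eqP/rowP => k.
have lX : \sum_(j < n.+1) l 0 j *: X j = 0.
  under eq_bigr => j _ do rewrite Xc scaler_sumr.
  rewrite exchange_big big1//= => i _.
  under eq_bigr => j _ do rewrite scalerA.
  rewrite -scaler_suml.
  have := congr1 (fun A : 'rV_n => A 0 i) lC; rewrite !mxE.
  under eq_bigr => j _ do rewrite mxE.
  by move=> ->; rewrite scale0r.
have := congr1 (fun x => on_words x (w0 k)) lX.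
rewrite {1}/on_words coord_sum (bigD1 k)//= big1 ?addr0; last first.
  by move=> j jk; rewrite -/(on_words _ _) Xw ifN ?mulr0// eq_sym.
rewrite -/(on_words _ _) Xw eqxx mxE => /eqP.
by rewrite mulf_eq0 expf_eq0 pnatr_eq0 andbF orbF => /eqP.
Qed.

(** * No isomorphism *)

Definition unit_seq j : seq_space R := fun i => (i == j)%:R.

Lemma unit_seq_c0 j : c0 R (unit_seq j).
Proof.
by apply: (@c0_finite_support _ _ j.+1) => m jm; rewrite /unit_seq gtn_eqF.
Qed.

(** A coordinate of [g] depends on finitely many coordinates of its argument
only, because [coord_local_bound] makes it vanish where these vanish. *)
Lemma coord_finite_support g m : linear_on (c0 R) g ->
  {within c0 R, continuous g} ->
  exists N, forall y L, (N <= L)%N -> c0 R y ->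
    (g y)`[m] = \sum_(j < L) y`[j] * (g (unit_seq j))`[m].
Proof.
move=> lg cg; have [N gN] := coord_local_bound m c0_linear lg cg.
exists N.+1 => y L NL y0.
rewrite -(coord_sum _ (fun j : 'I_L => y`[j]) (fun j => g (unit_seq j))).
rewrite -(linear_on_sum _ _ c0_linear lg); last by move=> i; exact: unit_seq_c0.
set S := \sum_(j < L) _.
have S0 : c0 R S.
  by apply: (subspace_sum _ _ c0_linear) => i; exact: unit_seq_c0.
have := gN ((-1) *: S + y) 0 (subspaceD _ c0_linear S0 y0).
rewrite mulr0 lg// => h.
have /h : forall i, (i < N.+1)%N -> `|(-1 *: S + y)`[i]| <= 0.
  move=> i iN; change (`|-1 * S`[i] + y`[i]| <= 0).
  have iL : (i < L)%N by exact: leq_trans NL.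
  rewrite /S coord_sum (bigD1 (Ordinal iL))//= big1 ?addr0; last first.
    move=> j ji; rewrite /unit_seq (negbTE (_ : i != j)) ?mulr0//.
    by apply: contraNneq ji => ij; apply/eqP/val_inj.
  by rewrite /unit_seq eqxx mulr1 mulN1r addNr normr0.
change (`|-1 * (g S)`[m] + (g y)`[m]| <= 0 -> (g y)`[m] = (g S)`[m]).
by rewrite normr_le0 mulN1r addrC subr_eq0 => /eqP.
Qed.

(** The sum is the value of [g] at a vector of signs. *)
Lemma row_sum_bound g C m L : linear_on (c0 R) g ->
  (forall x M n, c0 R x -> (forall i, `|x`[i]| <= M) ->
    `|(g x)`[n]| <= C * M) ->
  \sum_(j < L) `|(g (unit_seq j))`[m]| <= C.
Proof.
move=> lg gC.
pose y : seq_space R := \sum_(j < L) Num.sg (g (unit_seq j))`[m] *: unit_seq j.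
have y0 : c0 R y.
  by apply: (subspace_sum _ _ c0_linear) => i; exact: unit_seq_c0.
have y1 i : `|y`[i]| <= 1.
  rewrite /y coord_sum.
  have [iL|Li] := ltnP i L.
    rewrite (bigD1 (Ordinal iL))//= big1 ?addr0; last first.
      move=> j ji; rewrite /unit_seq (negbTE (_ : i != j)) ?mulr0//.
      by apply: contraNneq ji => ij; apply/eqP/val_inj.
    by rewrite /unit_seq eqxx mulr1 normr_sg; case: eqP.
  rewrite big1 ?normr0// => j _; rewrite /unit_seq gtn_eqF ?mulr0//.
  exact: leq_trans Li.
have := gC y 1 m y0 y1; rewrite mulr1; apply: le_trans.
rewrite /y (linear_on_sum _ _ c0_linear lg)//; last first.
  by move=> i; exact: unit_seq_c0.
rewrite coord_sum; apply: le_trans (ler_norm _).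
by apply: ler_sum => j _; rewrite normrEsg.
Qed.

(** Both sides are [3 ^- n] times the sum over [w] of [g (f (K w))] at [w],
where [K w] is the image of the indicator of [w] under the rescaled projection
[kern]. Since [g] inverts [f], this reads off the diagonal of [kern]; expanding
[g] along the unit sequences and recombining the [K w] by [kern_proj] gives the
sum over [j]. *)
Lemma trace_identity n f g :
  linear_on balanced_c0 f -> linear_on (c0 R) g ->
  {within c0 R, continuous g} ->
  (forall x, balanced_c0 x -> c0 R (f x)) ->
  (forall y, c0 R y -> balanced_c0 (g y)) ->
  (forall x, balanced_c0 x -> g (f x) = x) ->
  exists L, 2%:R ^+ n =
    \sum_(j < L) (f (block n (on_words (g (unit_seq j)))))`[j].
Proof.
move=> lf lg cg fE gE gf.
have [N HN] := choice (fun w : word => coord_finite_support (pickle w) lg cg).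
pose L := (\max_(w <- words n) N w)%N.
pose K w : seq_space R := block n (kern w).
have EK w : balanced_c0 (K w) := block_balanced n (kern_balanced w).
exists L; apply: (@mulfI _ (3%:R ^+ n)); first by rewrite expf_neq0// pnatr_eq0.
transitivity (\sum_(w <- words n) on_words (g (f (K w))) w).
  rewrite (@eq_big_seq _ _ _ _ _ _ (fun=> 2%:R ^+ n)).
    rewrite big_const_seq count_predT size_words iter_addr_0.
    by rewrite -[RHS]mulr_natl natrX.
  move=> w; rewrite mem_words => /eqP wn.
  by rewrite gf// block_on_words wn eqxx kern_diag wn.
rewrite (eq_big_seq (fun w => \sum_(j < L)
  (f (K w))`[j] * on_words (g (unit_seq j)) w)); last first.
  move=> w wn; apply: HN; last exact: fE.
  exact: leq_bigmax_seq.
rewrite exchange_big mulr_sumr; apply: eq_bigr => j _ /=.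
set b := on_words (g (unit_seq j)).
have bb : balanced b by have [] := gE _ (unit_seq_c0 j).
have Eb : balanced_c0 (block n b) by exact: block_balanced.
under eq_bigr => w _ do rewrite mulrC.
rewrite -(coord_sum _ b (fun w => f (K w))).
rewrite -(linear_on_sum _ _ balanced_c0_linear lf)//.
have -> : \sum_(w <- words n) b w *: K w = 3%:R ^+ n *: block n b.
  apply/funext => m.
  change ((\sum_(w <- words n) b w *: K w)`[m] =
    3%:R ^+ n * (block n b)`[m]).
  rewrite coord_sum /K /block; case: (pickle_inv m) => [u|].
    case: eqP => un; first exact: kern_proj.
    by rewrite big1 ?mulr0// => w _; rewrite mulr0.
  by rewrite big1 ?mulr0// => w _; rewrite mulr0.
by rewrite (linear_onZ _ balanced_c0_linear lf).
Qed.

(** The trace identity bounds [2 ^ n] by [A * B * (3 / 2) ^ n], which fails for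
large [n] because [(4 / 3) ^ n] is unbounded. *)
Lemma balanced_c0_not_isomorphic : ~ isomorphic (@balanced_c0 R) (c0 R).
Proof.
move=> [f [g [[fE gE] [gf fg] lf cf cg]]].
have lg : linear_on (c0 R) g.
  move=> a x y x0 y0; rewrite -{1}(fg x x0) -{1}(fg y y0) -lf; [|exact: gE..].
  by rewrite gf//; apply: subspaceD; [exact: balanced_c0_linear|exact: gE..].
have [A A0 fA] := uniform_bound balanced_c0_linear balanced_c0_closed lf cf fE.
have [B B0 gB] := uniform_bound c0_linear c0_closed lg cg
  (fun y cy => (gE y cy).1).
have [n] := geometric_unbounded (A * B); apply/negP; rewrite -leNgt.
have [L tr] := trace_identity n lf lg cg fE gE gf.
have p2 : 0 < 2%:R ^+ n :> R by rewrite exprn_gt0.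
have p3 : 0 < 3%:R ^+ n :> R by rewrite exprn_gt0.
pose b j := on_words (g (unit_seq j)).
have bb j : balanced (b j) by have [] := gE _ (unit_seq_c0 j).
have fb j : `|(f (block n (b j)))`[j]| <=
    A * (\sum_(w <- words n) `|b j w| / 2%:R ^+ n).
  apply: fA; first exact: block_balanced.
  move=> m; rewrite -mulr_suml ler_pdivlMr// /block.
  have s0 : 0 <= \sum_(w <- words n) `|b j w| by apply: sumr_ge0.
  case: (pickle_inv m) => [w|]; last by rewrite normr0 mul0r.
  case: eqP => wn; last by rewrite normr0 mul0r.
  by rewrite mulrC; exact: balanced_spread.
have : 2%:R ^+ n <= A * (B * (3%:R ^+ n / 2%:R ^+ n)).
  rewrite {1}tr; apply: le_trans (ler_norm _) _.
  apply: le_trans (ler_norm_sum _ _ _) _.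
  apply: (@le_trans _ _
    (\sum_(j < L) A * (\sum_(w <- words n) `|b j w| / 2%:R ^+ n))).
    by apply: ler_sum => j _; exact: fb.
  rewrite -mulr_sumr ler_wpM2l// exchange_big /=.
  apply: (@le_trans _ _ (\sum_(w <- words n) B / 2%:R ^+ n)).
    apply: ler_sum => w _; rewrite -mulr_suml ler_pM2r ?invr_gt0//.
    exact: row_sum_bound.
  rewrite big_const_seq count_predT size_words iter_addr_0.
  by rewrite -[X in X <= _]mulr_natl natrX mulrCA.
move=> h; rewrite expr_div_n ler_pdivrMr//.
have -> : 4%:R ^+ n = 2%:R ^+ n * 2%:R ^+ n :> R by rewrite -exprMn -natrM.
by rewrite -ler_pdivlMr//; apply: le_trans h _; rewrite !mulrA.
Qed.

End Main.

Theorem corollary14 (R : realType) :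
  exists E : set (seq_space R),
    [/\ linear_subspace E,
        closed_in (c0 R) E,
        infinite_dimensional E &
        ~ isomorphic E (c0 R)].
Proof.
exists balanced_c0; split.
- exact: balanced_c0_linear.
- exact: balanced_c0_closed.
- exact: balanced_c0_infinite.
- exact: balanced_c0_not_isomorphic.
Qed.
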